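(* Let $G$ be a map on a surface $S$ and let $F$ be an irreducible face of $G$. Then every edge on the boundary of $F$ is essentially noncontractible.
   Context: A surface is a compact two-dimensional manifold (without boundary). All graphs are simple (no loops, no multiple edges). A map on $S$ is a connected simple graph $G$ embedded in $S$ such that every face (connected component of $S\setminus G$) is homeomorphic to an open disk. A face $F$ whose boundary walk traverses the edges $v_1v_2, v_2v_3,\dots,v_mv_1$ in order is denoted $F=v_1v_2\cdots v_m$; the vertices $v_i$ need not be distinct, subscripts are taken modulo $m$, and $m$ is the size of $F$ ($F$ is an $m$-face). A face of size $m\ge 4$ is a large face. A large face $F=v_1\cdots v_m$ is an irreducible face if for every $i$ the vertices $v_i$ and $v_{i+2}$ are adjacent in $G$. If $v_1v_2, v_2v_3, v_3v_1$ are edges of $G$, their union is the $3$-cycle $v_1v_2v_3$. A $3$-cycle is essential if it does not bound a disk in $S$ (i.e., it is not contractible on $S$). An edge is essentially noncontractible if at least one $3$-cycle containing it is essential. *)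

(* Defs.v *)
From HB Require Import structures.
From mathcomp Require Import all_boot all_order all_algebra.
From mathcomp Require Import all_classical all_reals all_analysis.
Set Implicit Arguments.
Unset Strict Implicit.
Unset Printing Implicit Defensive.
Import Order.TTheory GRing.Theory Num.Theory.
Import numFieldNormedType.Exports.
Local Open Scope classical_set_scope.
Local Open Scope ring_scope.

Definition homeomorphism_on (X Y : topologicalType) (A : set X) (B : set Y)
    (f : X -> Y) : Prop :=
  [/\ set_bij A B f, {within A, continuous f} &
      exists2 g : Y -> X, {within B, continuous g}
                        & forall x, A x -> g (f x) = x].

Definition homeomorphic (X Y : topologicalType) (A : set X) (B : set Y) : Prop :=
  exists f : X -> Y, homeomorphism_on A B f.

(* The library norm on R * R is the sup norm, so the Euclidean disks are
   written out. *)
Definition open_disk (R : realType) : set (R * R) :=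
  [set z | z.1 ^+ 2 + z.2 ^+ 2 < 1].

Definition closed_disk (R : realType) : set (R * R) :=
  [set z | z.1 ^+ 2 + z.2 ^+ 2 <= 1].

Definition unit_circle (R : realType) : set (R * R) :=
  [set z | z.1 ^+ 2 + z.2 ^+ 2 = 1].

Arguments open_disk R _ : clear implicits.
Arguments closed_disk R _ : clear implicits.
Arguments unit_circle R _ : clear implicits.

Definition surface (R : realType) (S : topologicalType) : Prop :=
  [/\ hausdorff_space S, @second_countable S, compact [set: S] &
      forall x : S, exists U : set S,
        [/\ open U, U x & homeomorphic U (open_disk R)]].

Definition is_arc (R : realType) (S : topologicalType) (A : set S) (a b : S)
    : Prop :=
  exists f : R -> S, [/\ homeomorphism_on (`[0, 1] : set R) A f, f 0 = a & f 1 = b].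

(* A finite simple graph embedded in S.  [edge u v] is meaningful only when
   [adj u v]; it is the closed arc, endpoints included. *)
Record embedded_graph (R : realType) (S : topologicalType) := EmbeddedGraph {
  vertex : finType;
  adj : rel vertex;
  vpoint : vertex -> S;
  edge : vertex -> vertex -> set S;
  adj_sym : symmetric adj;
  adj_irrefl : irreflexive adj;
  point_inj : injective vpoint;
  edge_arc : forall u v, adj u v -> is_arc R (edge u v) (vpoint u) (vpoint v);
  edge_sym : forall u v, adj u v -> edge u v = edge v u;
  edge_point : forall u v w, adj u v -> edge u v (vpoint w) -> w = u \/ w = v;
  edge_disjoint : forall u v u' v', adj u v -> adj u' v' ->
    ~ (u = u' /\ v = v') -> ~ (u = v' /\ v = u') ->
    edge u v `&` edge u' v' `<=` range vpoint
}.

Definition graph_support (R : realType) (S : topologicalType)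
    (G : embedded_graph R S) : set S :=
  range (@vpoint R S G) `|`
  [set x | exists u v : vertex G, adj u v /\ edge u v x].

Definition is_face (R : realType) (S : topologicalType)
    (G : embedded_graph R S) (F : set S) : Prop :=
  exists2 x : S, ~ graph_support G x & F = connected_component (~` graph_support G) x.

Definition is_map (R : realType) (S : topologicalType)
    (G : embedded_graph R S) : Prop :=
  [/\ (0 < #|vertex G|)%N,
      forall u v : vertex G, connect (@adj R S G) u v &
      forall F, is_face G F -> homeomorphic F (open_disk R)].

Definition circle_point (R : realType) (t : R) : R * R := (cos t, sin t).

Definition corner_angle (R : realType) (m k : nat) : R :=
  2 * pi * k%:R / m%:R.

Definition circle_arc (R : realType) (m : nat) (i : 'I_m) : set (R * R) :=
  @circle_point R @` `[corner_angle R m i, corner_angle R m i.+1].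

Arguments circle_arc R {m} i _.

(* F = v_0 v_1 ... v_(m-1): the closed disk, its boundary circle cut into m
   equal arcs, maps to S so that the interior goes homeomorphically onto F and
   the i-th arc goes homeomorphically onto the edge v_i v_(i+1), starting at
   v_i.  Indices are cyclic through [ordS]. *)
Definition boundary_walk (R : realType) (S : topologicalType)
    (G : embedded_graph R S) (F : set S) (m : nat) (v : 'I_m -> vertex G)
    : Prop :=
  (0 < m)%N /\
  exists phi : R * R -> S,
    [/\ {within closed_disk R, continuous phi},
        homeomorphism_on (open_disk R) F phi &
        forall i : 'I_m,
          [/\ adj (v i) (v (ordS i)),
              homeomorphism_on (circle_arc R i) (edge (v i) (v (ordS i))) phi &
              phi (circle_point (corner_angle R m i)) = vpoint (v i)]].

Definition irreducible_face (R : realType) (S : topologicalType)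
    (G : embedded_graph R S) (F : set S) : Prop :=
  is_face G F /\
  exists (m : nat) (v : 'I_m -> vertex G),
    [/\ boundary_walk F v, (4 <= m)%N &
        forall i : 'I_m, adj (v i) (v (ordS (ordS i)))].

Definition on_boundary (R : realType) (S : topologicalType)
    (G : embedded_graph R S) (F : set S) (a b : vertex G) : Prop :=
  edge a b `<=` closure F `\` interior F.

Definition three_cycle (R : realType) (S : topologicalType)
    (G : embedded_graph R S) (a b c : vertex G) : Prop :=
  [/\ adj a b, adj b c & adj c a].

Definition three_cycle_set (R : realType) (S : topologicalType)
    (G : embedded_graph R S) (a b c : vertex G) : set S :=
  edge a b `|` edge b c `|` edge c a.

Definition bounds_disk (R : realType) (S : topologicalType) (C : set S) : Prop :=
  exists (D : set S) (h : R * R -> S),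
    homeomorphism_on (closed_disk R) D h /\ h @` unit_circle R = C.

Definition essential (R : realType) (S : topologicalType)
    (G : embedded_graph R S) (a b c : vertex G) : Prop :=
  three_cycle a b c /\ ~ bounds_disk R (three_cycle_set a b c).

Definition essentially_noncontractible (R : realType) (S : topologicalType)
    (G : embedded_graph R S) (a b : vertex G) : Prop :=
  exists c : vertex G, essential a b c.

(* Main.v *)
Require Import Defs.
From mathcomp Require Import all_boot all_order all_algebra.
From mathcomp Require Import all_classical all_reals all_analysis.
From mathcomp Require Import ring lra.
Set Implicit Arguments.
Unset Strict Implicit.
Unset Printing Implicit Defensive.
Import Order.TTheory GRing.Theory Num.Theory.
Import numFieldNormedType.Exports.
Local Open Scope classical_set_scope.
Local Open Scope ring_scope.

(** Every triangle on three consecutive vertices [u], [v], [w] of the boundary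
    walk is essential.  Suppose it bounds a disk [D].  The face [F] lies either
    in the interior of [D] or outside [D]; let [E] be that side.  Gluing the
    corner of [F] at [v] to the opposite side along the path [u v w] gives an
    injective map from a neighbourhood in the plane, which is open by invariance
    of domain.  Hence near [v] the side [E] is filled by this corner of [F], so
    [u] and [w] are the only neighbours of [v] on the boundary of [F], and the
    walk visits [v] only once.  Since the face is irreducible, the vertex after
    [w] is a neighbour of [v], hence equal to [u]; the same argument at [w] shows
    that the next vertex is [v] again, a second visit.

    Invariance of domain in the plane is obtained from a mod 2 degree: a
    nonvanishing map has even degree on the circle when it has a continuous
    square root up to positive scaling.  This is a homotopy invariant, holds for
    maps that extend to the disk without zeros, and fails for odd maps. *)

(** * Continuity on a subset *)

(** Pointwise form of [{within A, continuous f}]: limits along a filter combine by rules that the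
    tactic [contin] applies mechanically. *)
Definition contin_on (T U : topologicalType) (A : set T) (f : T -> U) :=
  forall x, A x -> f y @[y --> within A (nbhs x)] --> f x.

Lemma contin_onP (T U : topologicalType) (A : set T) (f : T -> U) :
  {within A, continuous f} <-> contin_on A f.
Proof. exact: subspace_continuousP. Qed.

Section ContinOn.
Variables (R : realType) (T U V : topologicalType) (A : set T).

Lemma contin_on_near (f : T -> U) x (N : set U) :
  contin_on A f -> A x -> nbhs (f x) N -> nbhs x (fun y => A y -> N (f y)).
Proof. by move=> fc Ax Nx; exact: (fc x Ax N Nx). Qed.

Lemma contin_on_sub (B : set T) (f : T -> U) :
  A `<=` B -> contin_on B f -> contin_on A f.
Proof.
move=> AB fc x Ax N Nx; have := fc x (AB _ Ax) N Nx.
by rewrite /within/= /nbhs/=; apply: filterS => y /= H Ay; exact: H (AB _ Ay).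
Qed.

Lemma contin_on_eq (f g : T -> U) :
  (forall x, A x -> f x = g x) -> contin_on A f -> contin_on A g.
Proof.
move=> fg fc x Ax N; rewrite -fg// => Nx; have := fc x Ax N Nx.
rewrite /within/= /nbhs/=; apply: filterS => y /= H Ay.
by rewrite /= -fg//; exact: H.
Qed.

Lemma contin_on_comp (B : set U) (f : T -> U) (g : U -> V) :
  contin_on A f -> contin_on B g -> (forall x, A x -> B (f x)) ->
  contin_on A (fun x => g (f x)).
Proof.
move=> fc gc AB x Ax N Nx; have := fc x Ax _ (gc _ (AB _ Ax) N Nx).
rewrite /within/= /nbhs/=; apply: filterS => y /= H Ay.
exact: H Ay (AB _ Ay).
Qed.

Lemma continuous_contin_on (f : T -> U) : continuous f -> contin_on A f.
Proof. by move=> fc x Ax; apply: cvg_within_filter; exact: fc. Qed.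

Lemma contin_on_id : contin_on A id.
Proof. by move=> x Ax; apply: cvg_within_filter; exact: cvg_id. Qed.

Lemma contin_on_cst (c : U) : contin_on A (fun=> c).
Proof. by apply: continuous_contin_on => x; exact: cvg_cst. Qed.

Lemma contin_on_pair (f : T -> U) (g : T -> V) :
  contin_on A f -> contin_on A g -> contin_on A (fun x => (f x, g x)).
Proof. by move=> fc gc x Ax; apply: cvg_pair; [exact: fc|exact: gc]. Qed.

Lemma contin_on_fst (f : T -> U * V) :
  contin_on A f -> contin_on A (fun x => (f x).1).
Proof. by move=> fc x Ax; apply: (cvg_comp _ _ (fc x Ax)); exact: cvg_fst. Qed.

Lemma contin_on_snd (f : T -> U * V) :
  contin_on A f -> contin_on A (fun x => (f x).2).
Proof. by move=> fc x Ax; apply: (cvg_comp _ _ (fc x Ax)); exact: cvg_snd. Qed.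

Lemma contin_onD (f g : T -> R) :
  contin_on A f -> contin_on A g -> contin_on A (fun x => f x + g x).
Proof. by move=> fc gc x Ax; apply: cvgD; [exact: fc|exact: gc]. Qed.

Lemma contin_onN (f : T -> R) : contin_on A f -> contin_on A (fun x => - f x).
Proof. by move=> fc x Ax; apply: cvgN; exact: fc. Qed.

Lemma contin_onM (f g : T -> R) :
  contin_on A f -> contin_on A g -> contin_on A (fun x => f x * g x).
Proof. by move=> fc gc x Ax; apply: cvgM; [exact: fc|exact: gc]. Qed.

Lemma contin_onX (f : T -> R) n :
  contin_on A f -> contin_on A (fun x => f x ^+ n).
Proof.
move=> fc x Ax; exact: (cvg_comp _ _ (fc x Ax) (@exprn_continuous R n (f x))).
Qed.

Lemma contin_onV (f : T -> R) : (forall x, A x -> f x != 0) ->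
  contin_on A f -> contin_on A (fun x => (f x)^-1).
Proof. by move=> f0 fc x Ax; apply: cvgV; [exact: f0|exact: fc]. Qed.

Lemma contin_on_sqrt (f : T -> R) :
  contin_on A f -> contin_on A (fun x => Num.sqrt (f x)).
Proof.
move=> fc x Ax; exact: (cvg_comp _ _ (fc x Ax) (@sqrt_continuous R (f x))).
Qed.

End ContinOn.

Lemma contin_on_near_gt0 (R : realType) (T : topologicalType) (A : set T)
    (f : T -> R) x :
  contin_on A f -> A x -> 0 < f x -> nbhs x (fun y => A y -> 0 < f y).
Proof.
move=> fc Ax fx.
have := @contin_on_near _ _ _ f x [set y | 0 < y] fc Ax; apply.
exact: lt_nbhsr.
Qed.

Ltac contin_step :=
  lazymatch goal with
  | |- contin_on _ (fun x => x) => exact: contin_on_id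
  | |- contin_on _ fst => apply: contin_on_fst; exact: contin_on_id
  | |- contin_on _ snd => apply: contin_on_snd; exact: contin_on_id
  | |- contin_on _ (fun _ => ?c) => exact: contin_on_cst
  | |- contin_on _ (fun x => (@?f x, @?g x)) => apply: contin_on_pair
  | |- contin_on _ (fun x => (@?f x).1) => apply: contin_on_fst
  | |- contin_on _ (fun x => (@?f x).2) => apply: contin_on_snd
  | |- contin_on _ (fun x => @?f x + @?g x) => apply: contin_onD
  | |- contin_on _ (fun x => - @?f x) => apply: contin_onN
  | |- contin_on _ (fun x => @?f x ^+ _) => apply: contin_onX
  | |- contin_on _ (fun x => @?f x * @?g x) => apply: contin_onM
  | |- contin_on _ (fun x => Num.sqrt (@?f x)) => apply: contin_on_sqrt
  | |- contin_on _ (fun x => (@?f x)^-1) => first [assumption | apply: contin_onV]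
  | _ => assumption
  end.

Ltac contin := repeat contin_step.

(** * A degree modulo 2 in the plane *)

Section Plane.
Variable R : realType.
Local Notation P := (R * R)%type.
Implicit Types u v z : P.

(** In complex notation [dot u v] and [cross u v] are the real and imaginary parts of conj u times
    v, and [csquare u] is the square of u. *)
Definition dot u v : R := u.1 * v.1 + u.2 * v.2.
Definition cross u v : R := u.1 * v.2 - u.2 * v.1.
Definition csquare u : P := (u.1 ^+ 2 - u.2 ^+ 2, 2 * u.1 * u.2).

Lemma dot_gt0 u : u <> (0, 0) -> 0 < dot u u.
Proof.
case: u => a b h; rewrite /dot/= -!expr2 lt_neqAle addr_ge0 ?sqr_ge0// andbT eq_sym.
rewrite paddr_eq0 ?sqr_ge0// !sqrf_eq0; apply/negP => /andP[/eqP e /eqP e'].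
by apply: h; rewrite e e'.
Qed.

(* [g] has a continuous square root on [X] up to positive scaling. *)
Definition has_root (T : topologicalType) (X : set T) (g : T -> P) :=
  exists q : T -> P, contin_on X q /\
    forall x, X x -> cross (g x) (csquare (q x)) = 0 /\
                     0 < dot (g x) (csquare (q x)).

(** Turns the sign conditions in [has_root] into an equation; the factor is [dot u v] divided by
    [dot u u]. *)
Lemma parallelP u v : cross u v = 0 -> 0 < dot u v ->
  exists2 k, 0 < k & v = (k * u.1, k * u.2).
Proof.
case: u v => [a b] [c d]; rewrite /cross/dot/= => e h.
have n0 : 0 < a ^+ 2 + b ^+ 2.
  rewrite !expr2; apply: (@dot_gt0 (a, b)) => -[a0 b0].
  by move: h; rewrite a0 b0 !mul0r addr0 ltxx.
exists ((a * c + b * d) / (a ^+ 2 + b ^+ 2)); first by rewrite divr_gt0.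
have {}e : a * d = b * c by lra.
have nz : a ^+ 2 + b ^+ 2 != 0 by rewrite gt_eqF.
congr pair; apply: (mulIf nz); rewrite mulrAC divfK//.
  by rewrite mulrDl -[b * d * a]mulrA [d * a]mulrC e; ring.
by rewrite mulrDl [a * c * b]mulrAC -[a * b * c]mulrA -e; ring.
Qed.

(* With [u = g1 * conj g2] in the right half-plane, [u + |u|] is a square root
   of [u] up to positive scaling. *)
Lemma has_root_close (T : topologicalType) (X : set T) (g1 g2 : T -> P) :
  contin_on X g1 -> contin_on X g2 ->
  (forall x, X x -> 0 < dot (g1 x) (g2 x)) ->
  has_root X g2 -> has_root X g1.
Proof.
move=> c1 c2 pos [q [qc qP]].
pose a x := dot (g1 x) (g2 x); pose b x := cross (g2 x) (g1 x).
pose s x := Num.sqrt (a x ^+ 2 + b x ^+ 2) + a x.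
exists (fun x => ((q x).1 * s x - (q x).2 * b x, (q x).1 * b x + (q x).2 * s x)).
split; first by rewrite /s /a /b /dot /cross; contin.
move=> x Xx; have [e d] := qP x Xx; have [k k0 ek] := parallelP e d.
have a0 : 0 < a x by exact: pos.
have r0 : 0 < Num.sqrt (a x ^+ 2 + b x ^+ 2).
  by rewrite sqrtr_gt0 ltr_wpDr ?sqr_ge0// exprn_gt0.
have rr : Num.sqrt (a x ^+ 2 + b x ^+ 2) ^+ 2 = a x ^+ 2 + b x ^+ 2.
  by rewrite sqr_sqrtr// addr_ge0// sqr_ge0.
rewrite /s; set r := Num.sqrt _ in rr r0 *.
(* Put u = a + i b and s = r + a. Then (s + i b)^2 = 2 s u, and q^2 = k g2, so the square of q (s +
   i b) is 2 s k |g2|^2 g1, a positive multiple of g1. *)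
have sqE : csquare ((q x).1 * (r + a x) - (q x).2 * b x,
                    (q x).1 * b x + (q x).2 * (r + a x)) =
  (2 * (r + a x) * k * dot (g2 x) (g2 x) * (g1 x).1,
   2 * (r + a x) * k * dot (g2 x) (g2 x) * (g1 x).2).
  have mE : csquare ((q x).1 * (r + a x) - (q x).2 * b x,
                    (q x).1 * b x + (q x).2 * (r + a x)) =
    ((csquare (q x)).1 * ((r + a x) ^+ 2 - b x ^+ 2) -
       (csquare (q x)).2 * (2 * (r + a x) * b x),
     (csquare (q x)).2 * ((r + a x) ^+ 2 - b x ^+ 2) +
       (csquare (q x)).1 * (2 * (r + a x) * b x)).
    by rewrite /csquare/=; congr pair; ring.
  have sE : (r + a x) ^+ 2 - b x ^+ 2 = 2 * (r + a x) * a x.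
    by rewrite sqrrD rr; ring.
  by rewrite mE sE ek /= /a /b /dot /cross; congr pair; ring.
rewrite sqE; split; first by rewrite /cross/=; ring.
have -> : dot (g1 x) (2 * (r + a x) * k * dot (g2 x) (g2 x) * (g1 x).1,
   2 * (r + a x) * k * dot (g2 x) (g2 x) * (g1 x).2) =
   2 * (r + a x) * k * (a x ^+ 2 + b x ^+ 2).
  by rewrite /a /b /dot /cross /=; ring.
rewrite -rr; apply: mulr_gt0; last exact: exprn_gt0.
apply: mulr_gt0 => //; apply: mulr_gt0 => //; exact: addr_gt0.
Qed.

(** The square of c + |c| is a positive multiple of c unless c lies on the negative real axis, where
    i serves as root. *)
Lemma has_root_cst (T : topologicalType) (X : set T) (c : P) :
  0 < dot c c -> has_root X (fun=> c).
Proof.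
move=> c0.
pose r := Num.sqrt (dot c c); have r0 : 0 < r by rewrite sqrtr_gt0.
have rr : r ^+ 2 = dot c c by rewrite sqr_sqrtr// ltW.
have [cp|cn] := ltP (- r) c.1.
  exists (fun=> (c.1 + r, c.2)); split; first by contin.
  move=> x _; split.
    have -> : cross c (csquare (c.1 + r, c.2)) = c.2 * (dot c c - r ^+ 2).
      by rewrite /cross/csquare/dot/=; ring.
    by rewrite rr subrr mulr0.
  have -> : dot c (csquare (c.1 + r, c.2)) = dot c c * (c.1 + 2 * r) + c.1 * r ^+ 2.
    by rewrite /cross/csquare/dot/=; ring.
  by rewrite rr [_ * dot c c]mulrC -mulrDr mulr_gt0//; lra.
have c2 : c.2 = 0.
  apply/eqP; rewrite -sqrf_eq0; apply/eqP.
  move: rr; rewrite /dot -!expr2 => rr.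
  have : 0 <= (- c.1 - r) * (- c.1 + r) by apply: mulr_ge0; lra.
  have := sqr_ge0 c.2; lra.
exists (fun=> (0, 1)); split; first by contin.
move=> x _; rewrite /cross/dot/csquare/= c2; split; first by ring.
by rewrite expr0n/= expr1n; nra.
Qed.

Local Notation I01 := (`[(0 : R), 1]%classic).

Lemma closed_le_contin (T : topologicalType) (f : T -> R) (c : R) :
  contin_on setT f -> closed [set x | f x <= c].
Proof.
move=> fc; rewrite -[X in closed X]setCK closedC openE => x /= /negP.
rewrite -ltNge => cx.
have : nbhs x (fun y => setT y -> 0 < f y - c).
  by apply: contin_on_near_gt0 => //; [contin|rewrite subr_gt0].
rewrite /interior; apply: filterS => y /(_ I); rewrite subr_gt0 => h /=.
by apply/negP; rewrite -ltNge.
Qed.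

Lemma compact_disk : compact (closed_disk R).
Proof.
apply: (@subclosed_compact _ _ (`[(-1 : R), 1]%classic `*` `[(-1 : R), 1]%classic)).
- by apply: closed_le_contin; contin.
- by apply: compact_setX; exact: segment_compact.
- move=> z; rewrite /closed_disk/= !in_itv/= -!ler_norml => h.
  have h1 : z.1 ^+ 2 <= 1 by have := sqr_ge0 z.2; lra.
  have h2 : z.2 ^+ 2 <= 1 by have := sqr_ge0 z.1; lra.
  by split; rewrite -(@expr_le1 _ 2)// real_normK// num_real.
Qed.

Lemma circle_sub_disk : unit_circle R `<=` closed_disk R.
Proof. by move=> z; rewrite /unit_circle/closed_disk/= => ->. Qed.

Lemma open_sub_disk : open_disk R `<=` closed_disk R.
Proof. by move=> z; rewrite /open_disk/closed_disk/=; exact: ltW. Qed.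

Lemma disk_cases z : closed_disk R z -> open_disk R z \/ unit_circle R z.
Proof.
rewrite /closed_disk/open_disk/unit_circle/= le_eqVlt => /orP[/eqP|]; by [right|left].
Qed.

Lemma compact_circle : compact (unit_circle R).
Proof.
apply: (subclosed_compact _ compact_disk circle_sub_disk).
have -> : unit_circle R =
    [set z | z.1 ^+ 2 + z.2 ^+ 2 <= 1] `&` [set z | - (z.1 ^+ 2 + z.2 ^+ 2) <= - 1].
  apply/seteqP; split => z; rewrite /unit_circle/= lerN2.
    by move=> ->; rewrite lexx.
  by case=> a b; apply/eqP; rewrite eq_le a b.
by apply: closedI; apply: closed_le_contin; contin.
Qed.

(** By compactness of [X], close parameters give maps with positive dot product on all of [X]. By
    [has_root_close] the parameters with a root form an open and closed subset of the unit
    interval. *)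
Lemma has_root_homotopy (T : topologicalType) (X : set T) (H : R -> T -> P) :
  compact X ->
  contin_on (X `*` I01) (fun p => H p.2 p.1) ->
  (forall s x, 0 <= s <= 1 -> X x -> 0 < dot (H s x) (H s x)) ->
  has_root X (H 0) -> has_root X (H 1).
Proof.
move=> cX Hc H0 r0; pose I := I01.
have Hs s : I s -> contin_on X (H s).
  move=> Is; apply: (contin_on_comp (f := fun x => (x, s)) _ Hc); first by contin.
  by move=> x Xx.
have close s : I s -> nbhs s (fun t => I t -> forall x, X x -> 0 < dot (H t x) (H s x)).
  move=> Is.
  have := (compact_near_coveringP X).1 cX R (nbhs s)
    (fun t x => I t -> X x -> 0 < dot (H t x) (H s x)) _ _.
  have K x : X x -> \forall x' \near x & t \near nbhs s,
      I t -> X x' -> 0 < dot (H t x') (H s x').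
    move=> Xx.
    have c' : contin_on (X `*` I) (fun p => H s p.1).
      apply: (contin_on_comp (f := fst) (B := X)); [by contin|exact: Hs|].
      by move=> p [].
    have : nbhs (x, s) (fun p => (X `*` I) p -> 0 < dot (H p.2 p.1) (H s p.1)).
      apply: contin_on_near_gt0; first by rewrite /dot; contin.
        by split.
      by apply: H0 => //; move: Is; rewrite /I/= in_itv.
    by apply: filterS => -[x' t] /= h It Xx'; exact: h.
  move=> /(_ _ K); rewrite /prop_near1; apply: filterS => t h It x Xx.
  exact: h.
(* Points outside the interval belong vacuously to both sets, so interiors taken in the whole line
   have the right traces on the interval. *)
pose good := [set s | I s -> has_root X (H s)].
pose bad := [set s | I s -> ~ has_root X (H s)].
have E : I `&` [set s | has_root X (H s)] = I.
  apply: (@segment_connected R 0 1).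
  - by exists 0; split => //=; rewrite /I/= in_itv/= lexx ler01.
  - exists (interior good); first exact: open_interior.
    apply/seteqP; split => s [Is rs]; split=> //.
      have := close s Is; rewrite /interior; apply: filterS => t h It.
      by apply: (has_root_close (Hs t It) (Hs s Is)) => // x Xx; exact: h.
    exact: nbhs_singleton rs Is.
  - exists (~` interior bad); first by rewrite closedC; exact: open_interior.
    apply/seteqP; split => s [Is rs]; split=> //.
      by move=> /nbhs_singleton/(_ Is).
    apply: contrapT => nr; apply: rs.
    have := close s Is; rewrite /interior; apply: filterS => t h It rt; apply: nr.
    apply: (has_root_close (Hs s Is) (Hs t It)) => // x Xx.
    by have := h It x Xx; rewrite /dot ![_ * (H t x).1]mulrC ![_ * (H t x).2]mulrC.
have : I 1 by rewrite /I/= in_itv/= lexx ler01.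
by rewrite -E => -[].
Qed.

(* A root [q] of an odd map satisfies [q (- z) = +/- i q z] up to positive
   scaling; the sign is constant by connectedness, but exchanging [z] and [- z]
   flips it. *)
Lemma odd_no_root (g : P -> P) :
  (forall z, unit_circle R z -> g (- z.1, - z.2) = (- (g z).1, - (g z).2)) ->
  ~ has_root (unit_circle R) g.
Proof.
move=> odd [q [qc qP]].
have Nc z : unit_circle R z -> unit_circle R (- z.1, - z.2).
  by rewrite /unit_circle/= !sqrrN.
pose k z := cross (q z) (q (- z.1, - z.2)).
have k0 z : unit_circle R z -> k z != 0.
  move=> cz; have [e1 d1] := qP z cz; have [e2 d2] := qP _ (Nc z cz).
  move: e2 d2; rewrite odd// => e2 d2.
  have [l l0 ql] := parallelP e1 d1; have [n n0 qn] := parallelP e2 d2.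
  have g0 : 0 < dot (g z) (g z).
    by apply: dot_gt0 => e; move: d1; rewrite e /dot/= !mul0r addr0 ltxx.
  apply/negP => /eqP kz.
  (* The two squares are positive multiples of g z and - g z, so their dot product is negative; if
     [k z] vanished, it would be a square. *)
  have : dot (csquare (q z)) (csquare (q (- z.1, - z.2))) =
     dot (q z) (q (- z.1, - z.2)) ^+ 2 - k z ^+ 2.
    by rewrite /k /dot /cross /csquare /=; ring.
  rewrite ql qn kz expr0n/= subr0.
  have -> : dot (l * (g z).1, l * (g z).2)
                (n * (- (g z).1, - (g z).2).1, n * (- (g z).1, - (g z).2).2) =
      - (l * n * dot (g z) (g z)) by rewrite /dot/=; ring.
  have := sqr_ge0 (dot (q z) (q (- z.1, - z.2))).
  have : 0 < l * n * dot (g z) (g z) by rewrite !mulr_gt0.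
  lra.
have cp t : unit_circle R (cos t, sin t) by rewrite /unit_circle/= cos2Dsin2.
have cc : contin_on `[(0 : R), pi]%classic (fun t : R => k (cos t, sin t)).
  have c1 : contin_on `[(0 : R), pi]%classic (fun t : R => cos t).
    by apply: continuous_contin_on; exact: continuous_cos.
  have c2 : contin_on `[(0 : R), pi]%classic (fun t : R => sin t).
    by apply: continuous_contin_on; exact: continuous_sin.
  have c3 : contin_on `[(0 : R), pi]%classic (fun t : R => q (cos t, sin t)).
    by apply: (contin_on_comp (f := fun t => (cos t, sin t)) _ qc); [contin|].
  have c4 : contin_on `[(0 : R), pi]%classic (fun t : R => q (- cos t, - sin t)).
    apply: (contin_on_comp (f := fun t => (- cos t, - sin t)) _ qc); first by contin.
    by move=> t _; exact: (Nc (cos t, sin t)).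
  by rewrite /k/cross/=; contin.
(* [cross] is antisymmetric, so [k] takes opposite values at the two ends of the upper half
   circle. *)
have kpi : k (cos pi, sin pi) = - k (cos 0, sin 0).
  by rewrite cospi sinpi cos0 sin0 /k/= opprK !oppr0 /cross; ring.
have [] := @IVT R (fun t => k (cos t, sin t)) 0 pi 0 (pi_ge0 R).
- by apply/contin_onP.
- rewrite kpi; set a := k _.
  by case: (lerP a (- a)) => h; rewrite ?ge_min ?le_max; lra.
- by move=> c _ /eqP; apply/negP/k0.
Qed.

(** If a value y near f(0) were missed, f - y would have a root on the circle, hence so would f -
    f(0). Injectivity lets f - f(0) be deformed without zeros into an odd map, which has no root. *)
Lemma open_map_disk (f : P -> P) :
  contin_on (closed_disk R) f ->
  {in closed_disk R &, injective f} ->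
  nbhs (f (0, 0)) (f @` closed_disk R).
Proof.
move=> fc fi; set f0 := f (0, 0).
have d0 : closed_disk R (0, 0) by rewrite /closed_disk/= expr0n/= addr0 ler01.
have inj z w : closed_disk R z -> closed_disk R w -> f z = f w -> z = w.
  by move=> dz dw; apply: fi; rewrite inE.
have sub_neq a b : a <> b -> (a.1 - b.1, a.2 - b.2) <> (0, 0) :> P.
  case: a b => [a1 a2] [b1 b2] /= h [/eqP e /eqP e']; apply: h.
  by move: e e'; rewrite !subr_eq0 => /eqP -> /eqP ->.
have fcc := contin_on_sub circle_sub_disk fc.
pose g y z : P := ((f z).1 - y.1, (f z).2 - y.2).
have gc y : contin_on (unit_circle R) (g y) by rewrite /g; contin.
have c10 : unit_circle R (1, 0) by rewrite /unit_circle/= expr1n expr0n/= addr0.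
(* [f c] is the point of the image of the circle nearest to [f0]; only values [y] closer to [f0]
   than [f c] are considered. *)
have [||c cc cmin] :=
  @compact_EVT_min _ R (fun z => dot (g f0 z) (g f0 z)) _ _ compact_circle.
- by exists (1, 0).
- by have gc0 := gc f0; apply/contin_onP; rewrite /dot; contin.
have circle0 z : unit_circle R z -> z <> (0, 0).
  move=> cz e; move: cz; rewrite e /unit_circle/= expr0n/= addr0 => /eqP.
  by rewrite eq_sym oner_eq0.
have m0 : 0 < dot (g f0 c) (g f0 c).
  rewrite inE in cc; apply: dot_gt0; apply: sub_neq => /inj h.
  exact: (circle0 c cc (h (circle_sub_disk cc) d0)).
have N : nbhs f0 (fun y => setT y ->
    0 < dot (g f0 c) (g f0 c) - ((y.1 - f0.1) ^+ 2 + (y.2 - f0.2) ^+ 2)).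
  apply: contin_on_near_gt0 => //; first by contin.
  by rewrite !subrr expr0n/= addr0 subr0.
apply: filterS N => y /(_ I) ym.
apply: contrapT => ny.
have scale (s : R) z : 0 <= s <= 1 -> closed_disk R z ->
    closed_disk R (s * z.1, s * z.2).
  move=> /andP[s0 s1]; rewrite /closed_disk/= !exprMn -mulrDr => dz.
  by rewrite mulr_ile1// ?addr_ge0 ?sqr_ge0// exprn_ile1.
have scaleN z : closed_disk R z -> closed_disk R (- z.1, - z.2).
  by rewrite /closed_disk/= !sqrrN.
have root_y : has_root (unit_circle R) (g y).
  (* Shrinking the circle to the centre joins [g y] to a constant map; no zero occurs because [y] is
     not a value of [f]. *)
  have := @has_root_homotopy _ _
    (fun s z => ((f (s * z.1, s * z.2)).1 - y.1, (f (s * z.1, s * z.2)).2 - y.2))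
    compact_circle.
  have E s : (fun z : P => ((f (s * z.1, s * z.2)).1 - y.1,
                            (f (s * z.1, s * z.2)).2 - y.2)) =
     (fun z : P => g y (s * z.1, s * z.2)) by [].
  rewrite !E.
  have -> : (fun z : P => g y (1 * z.1, 1 * z.2)) = g y.
    by apply/funext => -[z1 z2]; rewrite /= !mul1r.
  have -> : (fun z : P => g y (0 * z.1, 0 * z.2)) = fun=> g y (0, 0).
    by apply/funext => -[z1 z2]; rewrite /= !mul0r.
  apply.
  - have cf : contin_on (unit_circle R `*` I01)
        (fun p : P * R => f (p.2 * p.1.1, p.2 * p.1.2)).
      apply: (contin_on_comp (f := fun p : P * R => (p.2 * p.1.1, p.2 * p.1.2)) _ fc).
        by contin.
      move=> p [/circle_sub_disk cp]; rewrite /= in_itv/= => sp; exact: scale.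
    by contin.
  - move=> s z sI /circle_sub_disk cz; apply: dot_gt0; apply: sub_neq => e.
    by apply: ny; exists (s * z.1, s * z.2) => //; exact: scale.
  - apply: has_root_cst; apply: dot_gt0; apply: sub_neq => e.
    by apply: ny; exists (0, 0).
have root_0 : has_root (unit_circle R) (g f0).
  (* On the circle |f z - f0| > |y - f0|, so f z - f0 and f z - y form an acute angle. *)
  apply: (has_root_close (gc f0) (gc y) _ root_y) => z cz.
  have := cmin z; rewrite inE => /(_ cz) h.
  move: ym h; rewrite /g /dot /= => ym h.
  have := sqr_ge0 ((f z).1 - f0.1 - (y.1 - f0.1)).
  have := sqr_ge0 ((f z).2 - f0.2 - (y.2 - f0.2)).
  rewrite !expr2; rewrite !expr2 in ym; lra.
(* H s z = f(z / (1 + s)) - f(- s z / (1 + s)). The two arguments differ by z, so injectivity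
   excludes zeros; s = 0 gives [g f0] and s = 1 an odd map. *)
pose H s z : P := ((f ((1 + s)^-1 * z.1, (1 + s)^-1 * z.2)).1
                   - (f (- (s * (1 + s)^-1 * z.1), - (s * (1 + s)^-1 * z.2))).1,
                   (f ((1 + s)^-1 * z.1, (1 + s)^-1 * z.2)).2
                   - (f (- (s * (1 + s)^-1 * z.1), - (s * (1 + s)^-1 * z.2))).2).
have sc (s : R) : 0 <= s <= 1 ->
    [/\ 0 < 1 + s, 0 <= (1 + s)^-1 <= 1 & 0 <= s * (1 + s)^-1 <= 1].
  move=> /andP[s0 s1]; have p : 0 < 1 + s by lra.
  split=> //; first by rewrite invr_ge0 (ltW p)/= invf_le1// lerDl.
  by rewrite mulr_ge0 ?invr_ge0 ?(ltW p)//= ler_pdivrMr// mul1r lerDr.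
apply: (@odd_no_root (H 1)).
  move=> z cz; rewrite /H/= !mulrN !opprK !mul1r; congr pair; ring.
apply: has_root_homotopy compact_circle _ _ _.
- have cV : contin_on (unit_circle R `*` I01) (fun p : P * R => (1 + p.2)^-1).
    apply: contin_onV; last by contin.
    by move=> p [_]; rewrite /= in_itv/= => /sc[h _ _]; rewrite gt_eqF.
  have c1 : contin_on (unit_circle R `*` I01)
      (fun p : P * R => f ((1 + p.2)^-1 * p.1.1, (1 + p.2)^-1 * p.1.2)).
    apply: (contin_on_comp
      (f := fun p : P * R => ((1 + p.2)^-1 * p.1.1, (1 + p.2)^-1 * p.1.2)) _ fc).
      by contin.
    by move=> p [/circle_sub_disk cp]; rewrite /= in_itv/= => /sc[_ h _]; exact: scale.
  have c2 : contin_on (unit_circle R `*` I01)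
      (fun p : P * R => f (- (p.2 * (1 + p.2)^-1 * p.1.1),
                           - (p.2 * (1 + p.2)^-1 * p.1.2))).
    apply: (contin_on_comp (f := fun p : P * R => (- (p.2 * (1 + p.2)^-1 * p.1.1),
      - (p.2 * (1 + p.2)^-1 * p.1.2))) _ fc).
      by contin.
    move=> p [/circle_sub_disk cp]; rewrite /= in_itv/= => /sc[_ _ h].
    by have := scaleN _ (scale _ _ h cp).
  by rewrite /H; contin.
- move=> s z sI cz; have [p h1 h2] := sc s sI; have dz := circle_sub_disk cz.
  apply: dot_gt0; apply: sub_neq => e.
  have := inj _ _ (scale _ _ h1 dz) (scaleN _ (scale _ _ h2 dz)) e.
  case: z cz {dz e} => z1 z2 cz /= [e1 e2].
  have K x : (1 + s)^-1 * x = - (s * (1 + s)^-1 * x) -> x = 0.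
    move=> e; have : (1 + s) * (1 + s)^-1 * x = 0.
      by rewrite mulrDl mul1r mulrDl e; ring.
    by rewrite mulfV ?gt_eqF// mul1r.
  by apply: (circle0 _ cz); rewrite (K _ e1) (K _ e2).
- suff -> : H 0 = g f0 by [].
  by apply/funext => -[z1 z2]; rewrite /H/g/= addr0 invr1 !mul1r !mul0r oppr0.
Qed.

(** * Invariance of domain *)

(** Euclidean, unlike the balls of the product norm, so that it is a scaled and translated
    [closed_disk]. *)
Definition cball (p : P) (r : R) : set P :=
  [set z | (z.1 - p.1) ^+ 2 + (z.2 - p.2) ^+ 2 <= r ^+ 2].

Lemma cball_nbhs p (N : set P) :
  nbhs p N -> exists2 r, 0 < r & cball p r `<=` N.
Proof.
move=> /nbhs_ballP[e /= e0 eN]; exists (e / 2); first by rewrite divr_gt0.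
move=> z; rewrite /cball/= => h; apply: eN.
have e2 : 0 <= e / 2 by rewrite ltW// divr_gt0.
have lt x : x ^+ 2 <= (e / 2) ^+ 2 -> `|- x| < e.
  rewrite normrN -[x ^+ 2]real_normK ?num_real// ler_pXn2r ?nnegrE//; lra.
split; rewrite /ball/= -opprB; apply: lt; apply: le_trans h.
  by rewrite lerDl sqr_ge0.
by rewrite lerDr sqr_ge0.
Qed.

Lemma cball_center p r : cball p r p.
Proof. by rewrite /cball/= !subrr expr0n/= addr0 sqr_ge0. Qed.

Lemma cball_sub p r s : 0 <= s <= r -> cball p s `<=` cball p r.
Proof.
move=> /andP[s0 sr] z /le_trans; apply.
by rewrite ler_pXn2r// nnegrE// (le_trans s0 sr).
Qed.

Lemma closed_cball p r : closed (cball p r).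
Proof. by apply: closed_le_contin; contin. Qed.

(** A property of the target space, since the gluing below takes place both in the plane and in the
    surface. *)
Definition domain_invariant (T : topologicalType) :=
  forall (f : P -> T) p r, 0 < r -> contin_on (cball p r) f ->
    (forall z w, cball p r z -> cball p r w -> f z = f w -> z = w) ->
    nbhs (f p) (f @` cball p r).

Lemma plane_domain_invariant : domain_invariant (R * R)%type.
Proof.
move=> f p r r0 fc fi.
pose e z : P := (p.1 + r * z.1, p.2 + r * z.2).
have eb z : closed_disk R z -> cball p r (e z).
  rewrite /closed_disk/cball/e/= => h.
  by rewrite ![_ + _ * _ - _]addrAC !subrr !add0r !exprMn -mulrDr ger_pMr// exprn_gt0.
have := @open_map_disk (fun z => f (e z)).
have -> : e (0, 0) = p by rewrite /e/= !mulr0 !addr0; case: (p).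
have fec : contin_on (closed_disk R) (fun z => f (e z)).
  by apply: contin_on_comp fc eb; rewrite /e; contin.
move=> /(_ fec) h; apply: filterS (h _).
  by move=> _ [z dz <-]; exists (e z) => //; exact: eb.
move=> z w; rewrite !inE => dz dw e'; have := fi _ _ (eb _ dz) (eb _ dw) e'.
have rI : injective ( *%R r) by apply: mulfI; rewrite gt_eqF.
by case: z w {dz dw e'} => [z1 z2] [w1 w2] [/addrI/rI -> /addrI/rI ->].
Qed.

(** On a smaller ball the image stays in one chart domain; the plane case applies to the composite
    with the chart, and the chart pulls the neighbourhood back. *)
Lemma surface_domain_invariant (S : topologicalType) :
  surface R S -> domain_invariant S.
Proof.
move=> [_ _ _ chart] f p r r0 fc fi.
have [W [oW Wp [c [[cW ci _] /contin_onP cc [c' /contin_onP c'c cK]]]]] := chart (f p).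
have nW : nbhs (f p) W by exact: open_nbhs_nbhs.
have [r1 r10 r1W] := cball_nbhs (contin_on_near fc (cball_center p r) nW).
pose s := Num.min r r1.
have s0 : 0 < s by rewrite lt_min r0 r10.
have sr : cball p s `<=` cball p r by apply: cball_sub; rewrite (ltW s0)/= ge_min lexx.
have sW z : cball p s z -> W (f z).
  move=> sz; apply: r1W (sr _ sz); apply: cball_sub sz.
  by rewrite (ltW s0)/= ge_min lexx orbT.
have cfc : contin_on (cball p s) (fun z => c (f z)).
  by apply: contin_on_comp cc sW; exact: contin_on_sub sr fc.
have cfi z w : cball p s z -> cball p s w -> c (f z) = c (f w) -> z = w.
  move=> sz sw e; apply: fi; [exact: sr|exact: sr|].
  by rewrite -(cK (f z) (sW _ sz)) e cK//; exact: sW.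
have h := contin_on_near cc Wp (plane_domain_invariant s0 cfc cfi).
apply: filterS2 h nW => y hy Wy; have [z sz e] := hy Wy.
by exists z; [exact: sr|rewrite -(cK (f z) (sW _ sz)) e cK].
Qed.

(** A continuous injection of a compact set into a Hausdorff space maps closed subsets to closed
    sets. Off the image the inverse takes the default value (0, 0). *)
Lemma contin_on_inverse (T : topologicalType) (A : set P) (f : P -> T) :
  hausdorff_space T -> compact A -> contin_on A f ->
  (forall a b, A a -> A b -> f a = f b -> a = b) ->
  exists s : T -> P, (forall a, A a -> s (f a) = a) /\ contin_on (f @` A) s.
Proof.
move=> hT cA fc fi; pose s y := xget (0, 0) [set a | A a /\ f a = y].
have sK a : A a -> s (f a) = a.
  move=> Aa; have [] := @xgetPex _ (0, 0) [set b | A b /\ f b = f a].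
    by exists a.
  by move=> Ab e; exact: fi.
exists s; split=> // _ [a Aa <-] N; rewrite sK// => Na.
pose B := A `&` ~` interior N.
have cB : compact B.
  apply: (subclosed_compact _ cA) => [|b []//].
  apply: closedI; first exact: compact_closed (@norm_hausdorff _ _) cA.
  by rewrite closedC; exact: open_interior.
have : closed (f @` B).
  apply: compact_closed => //; apply: continuous_compact => //.
  by apply/contin_onP; apply: contin_on_sub fc => b [].
rewrite -openC => oB.
have : nbhs (f a) (~` (f @` B)).
  apply: open_nbhs_nbhs; split=> // -[b [Ab Nb] /(fi _ _ Ab Aa) e].
  by apply: Nb; rewrite e.
rewrite /within/= /nbhs/=; apply: filterS => y /= nB [b Ab e]; rewrite -e/= sK//.
apply: contrapT => nN; apply: nB; exists b => //; split=> //.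
by move=> /interior_subset.
Qed.

(** * The side of a circle containing a disk *)

Definition norm2 (z : P) : R := Num.sqrt (z.1 ^+ 2 + z.2 ^+ 2).

Definition radial (z : P) : P := (z.1 / norm2 z, z.2 / norm2 z).

Definition punctured : set P := [set z | 0 < z.1 ^+ 2 + z.2 ^+ 2].

(** The centre is left out because one of the maps to be glued, z to (2 - |z|) z / |z|, is not
    continuous there. *)
Definition punctured_disk : set P := punctured `&` closed_disk R.

Lemma norm2_sqr z : norm2 z ^+ 2 = z.1 ^+ 2 + z.2 ^+ 2.
Proof. by rewrite sqr_sqrtr// addr_ge0// sqr_ge0. Qed.

Lemma norm2_gt0 z : punctured z -> 0 < norm2 z.
Proof. by rewrite /punctured /norm2 sqrtr_gt0. Qed.

Lemma norm2_ge0 z : 0 <= norm2 z.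
Proof. exact: sqrtr_ge0. Qed.

Lemma norm2_circle z : unit_circle R z -> norm2 z = 1.
Proof. by rewrite /unit_circle/= /norm2 => ->; rewrite sqrtr1. Qed.

Lemma norm2_scale (c : R) u : unit_circle R u -> 0 <= c ->
  norm2 (c * u.1, c * u.2) = c.
Proof.
move=> cu c0; rewrite /norm2/= !exprMn -mulrDr cu mulr1 sqrtr_sqr.
by rewrite ger0_norm.
Qed.

Lemma circle_punctured z : unit_circle R z -> punctured z.
Proof. by rewrite /unit_circle/punctured/= => ->; exact: ltr01. Qed.

Lemma circle_punctured_disk z : unit_circle R z -> punctured_disk z.
Proof. by move=> cz; split; [exact: circle_punctured|exact: circle_sub_disk]. Qed.

Lemma radial_circle z : unit_circle R z -> radial z = z.
Proof. by move=> cz; rewrite /radial norm2_circle// !divr1; case: (z). Qed.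

Lemma radial_on_circle z : punctured z -> unit_circle R (radial z).
Proof.
move=> pz; rewrite /unit_circle/radial/= !exprMn -mulrDl -norm2_sqr exprVn mulfV//.
by rewrite sqrf_eq0 gt_eqF// norm2_gt0.
Qed.

Lemma radial_inj z w : punctured z -> norm2 z = norm2 w -> radial z = radial w ->
  z = w.
Proof.
move=> /norm2_gt0 pz e; rewrite /radial -e => -[].
have n0 : (norm2 z)^-1 != 0 by rewrite invr_neq0// gt_eqF.
move: (norm2 z)^-1 n0 => c c0 /(mulIf c0) e1 /(mulIf c0) e2.
by case: z w e1 e2 {pz e} => [z1 z2] [w1 w2] /= -> ->.
Qed.

Lemma contin_norm2 (X : set P) : contin_on X norm2.
Proof. by rewrite /norm2; contin. Qed.

Lemma contin_radial (X : set P) : X `<=` punctured -> contin_on X radial.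
Proof.
move=> Xp; have nc := contin_norm2 (X := X).
have n0 z : X z -> norm2 z != 0 by move=> /Xp/norm2_gt0/lt0r_neq0.
by rewrite /radial; contin.
Qed.

(* The disk [psi], attached to [k] along [psi @` A], fills the other side of
   the boundary: with [s] the inverse of [psi] on [A], the map equal to [k] on
   the disk and to [psi ((2 - |z|) s (k (z / |z|)))] outside is injective near
   [p], hence open. *)
Lemma glue_disks (T : topologicalType) (k psi : P -> T) (A M : set P) (p x0 : P) :
  hausdorff_space T -> domain_invariant T ->
  contin_on punctured_disk k ->
  (forall z w, punctured_disk z -> punctured_disk w -> k z = k w -> z = w) ->
  contin_on (closed_disk R) psi -> compact A -> A `<=` unit_circle R ->
  (forall z w, (open_disk R `|` A) z -> (open_disk R `|` A) w ->
    psi z = psi w -> z = w) ->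
  (forall z w, punctured_disk z -> open_disk R w -> k z <> psi w) ->
  unit_circle R p -> A x0 -> psi x0 = k p ->
  nbhs p (fun w => unit_circle R w -> (psi @` A) (k w)) ->
  nbhs x0 M ->
  nbhs (k p) (k @` punctured_disk `|` psi @` (M `&` open_disk R)).
Proof.
move=> hT iT kc ki pc cA AC pi kp cp Ax0 e0 nA nM.
have AD z : A z -> closed_disk R z by move=> /AC/circle_sub_disk.
have [||s [sK sc]] := contin_on_inverse hT cA (f := psi).
- exact: contin_on_sub AD pc.
- by move=> a b Aa Ab; apply: pi; right.
(* The points where the outer formula makes sense: their radial projection lands in the part of the
   boundary covered by [A]. *)
pose Z : set P := [set z | punctured z /\ (psi @` A) (k (radial z))].
have Zp : Z `<=` punctured by move=> z [].
pose S z := s (k (radial z)).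
have ZS z : Z z -> A (S z) /\ psi (S z) = k (radial z).
  by move=> [_ [a Aa e]]; rewrite /S -e sK.
have Sc : contin_on Z S.
  apply: contin_on_comp sc _; last by move=> z [].
  apply: contin_on_comp kc _; first exact: contin_radial.
  by move=> z [pz _]; apply/circle_punctured_disk/radial_on_circle.
(* Reflects the outside of the circle into the second disk: |tau z| = 2 - |z|, and on the circle
   [tau] is [S]. *)
pose tau z : P := ((2 - norm2 z) * (S z).1, (2 - norm2 z) * (S z).2).
have tc : contin_on Z tau by have nc := contin_norm2 (X := Z); rewrite /tau; contin.
have Zcirc : Z p.
  split; first exact: circle_punctured.
  by rewrite radial_circle// -e0; exists x0.
have taup : tau p = x0.
  rewrite /tau norm2_circle// /S radial_circle// -e0 sK//.
  by rewrite (_ : 2 - 1 = 1) ?mul1r; [case: (x0)|ring].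
have pp := circle_punctured cp.
have n1 : nbhs p punctured.
  have : nbhs p (fun z => setT z -> 0 < z.1 ^+ 2 + z.2 ^+ 2).
    by apply: contin_on_near_gt0 => //; contin.
  by apply: filterS => z; apply.
have n2 : nbhs p (fun z => punctured z -> unit_circle R (radial z) ->
    (psi @` A) (k (radial z))).
  have rc := @contin_radial punctured (fun z h => h).
  apply: (contin_on_near (N := fun w => unit_circle R w -> (psi @` A) (k w)) rc pp).
  by rewrite radial_circle.
have n3 : nbhs p (fun z => Z z -> M (tau z)).
  by apply: (contin_on_near tc) => //; rewrite taup.
have n4 : nbhs p (fun z => setT z -> 0 < 2 - norm2 z).
  apply: contin_on_near_gt0 => //; last by rewrite norm2_circle//; lra.
  by have nc := contin_norm2 (X := setT); contin.
have n : nbhs p (fun z => [/\ Z z, M (tau z) & norm2 z < 2]).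
  apply: filterS (filterI n1 (filterI n2 (filterI n3 n4))) => z [pz [h2 [h3 h4]]].
  have Zz : Z z by split=> //; exact: h2 pz (radial_on_circle pz).
  by split; [|exact: h3|have := h4 I; rewrite subr_gt0].
have [r r0 rn] := cball_nbhs n.
have tauD z : cball p r z -> 1 <= norm2 z -> closed_disk R (tau z).
  move=> /rn[/ZS[/AC a _] _ z2] z1.
  move: a; rewrite /unit_circle/closed_disk/= !exprMn -mulrDr => ->.
  by rewrite mulr1 expr_le1//; lra.
have tauO z : cball p r z -> 1 < norm2 z -> open_disk R (tau z).
  move=> /rn[/ZS[/AC a _] _ z2] z1.
  move: a; rewrite /unit_circle/open_disk/= !exprMn -mulrDr => ->.
  by rewrite mulr1 expr_lt1//; lra.
pose f z := if norm2 z <= 1 then k z else psi (tau z).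
have inD z : cball p r z -> norm2 z <= 1 -> punctured_disk z.
  move=> /rn[[pz _] _ _] z1; split=> //.
  by rewrite /closed_disk/= -norm2_sqr expr_le1// norm2_ge0.
(* Pasting along two closed pieces; on |z| = 1 both formulas give [k z]. *)
have fc : contin_on (cball p r) f.
  pose B1 := cball p r `&` [set z | norm2 z <= 1].
  pose B2 := cball p r `&` [set z | - norm2 z <= - 1].
  have -> : cball p r = B1 `|` B2.
    rewrite -setIUr; apply/esym/setIidPl => z _ /=; rewrite lerN2.
    by case: (leP (norm2 z) 1) => h; [left|right; exact: ltW].
  apply/contin_onP; apply: withinU_continuous.
  - apply: closedI; [exact: closed_cball|apply: closed_le_contin].
    exact: contin_norm2.
  - apply: closedI; [exact: closed_cball|apply: closed_le_contin].
    by have nc := contin_norm2 (X := setT); contin.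
  - apply/contin_onP; apply: (contin_on_eq (f := k)).
      by move=> z [_ /= z1]; rewrite /f z1.
    by apply: contin_on_sub kc => z [bz z1]; exact: inD.
  - apply/contin_onP; apply: (contin_on_eq (f := fun z => psi (tau z))).
      move=> z [bz /=]; rewrite lerN2 /f => z1; case: ifP => // z1'.
      have e1 : norm2 z = 1 by apply/eqP; rewrite eq_le z1 z1'.
      have cz : unit_circle R z by rewrite /unit_circle/= -norm2_sqr e1 expr1n.
      have [/ZS[_ e] _ _] := rn _ bz.
      rewrite /tau e1 (_ : 2 - 1 = 1); last by ring.
      by rewrite !mul1r; case: (S z) e => a b /= ->; rewrite radial_circle.
    apply: contin_on_comp pc _.
      by apply: contin_on_sub tc => z [/rn[]].
    by move=> z [bz /=]; rewrite lerN2; exact: tauD.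
have norm_tau z : cball p r z -> norm2 (tau z) = 2 - norm2 z.
  by move=> /rn[/ZS[/AC a _] _ z2]; rewrite norm2_scale// subr_ge0 ltW.
(* Mixed cases contradict [kp]. Outside the circle |tau z| determines |z|, and then [tau z]
   determines [S z], hence the direction of z. *)
have fi z w : cball p r z -> cball p r w -> f z = f w -> z = w.
  move=> bz bw; rewrite /f; case: leP => z1; case: leP => w1.
  - by apply: ki; exact: inD.
  - by move=> e; case: (kp _ _ (inD _ bz z1) (tauO _ bw w1)).
  - by move=> /esym e; case: (kp _ _ (inD _ bw w1) (tauO _ bz z1)).
  move=> /pi e; have {}e : tau z = tau w by apply: e; left; exact: tauO.
  have [[pz _] _ z2] := rn _ bz; have [[pw _] _ w2] := rn _ bw.
  have en : norm2 z = norm2 w.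
    by have := congr1 norm2 e; rewrite !norm_tau// => /addrI/oppr_inj.
  have [[/ZS[_ Sz] _ _] [/ZS[_ Sw] _ _]] := (rn _ bz, rn _ bw).
  apply: radial_inj => //; apply: ki.
  - exact/circle_punctured_disk/radial_on_circle.
  - exact/circle_punctured_disk/radial_on_circle.
  rewrite -Sz -Sw; congr psi.
  have n0 : 2 - norm2 w != 0 by rewrite gt_eqF// subr_gt0.
  move: e; rewrite /tau en => -[].
  by case: (S z) (S w) => [a b] [c d] /= /(mulfI n0) -> /(mulfI n0) ->.
have := iT f p r r0 fc fi.
rewrite {1}/f norm2_circle// lexx; apply: filterS => _ [z bz <-].
rewrite /f; case: leP => z1; first by left; exists z => //; exact: inD.
have [_ Mz _] := rn _ bz.
by right; exists (tau z) => //; split => //; exact: tauO.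
Qed.

Lemma disk_dense z (N : set P) :
  closed_disk R z -> nbhs z N -> exists2 w, open_disk R w & N w.
Proof.
(* Scaling by [1 - e] brings z into the open disk and moves it by at most [e]. *)
move=> dz /cball_nbhs[r r0 rN]; pose e := Num.min r 1.
have e0 : 0 < e by rewrite lt_min r0 ltr01.
have e1 : e <= 1 by rewrite ge_min lexx orbT.
have er : e <= r by rewrite ge_min lexx.
have nz : 0 <= z.1 ^+ 2 + z.2 ^+ 2 by rewrite addr_ge0// sqr_ge0.
exists ((1 - e) * z.1, (1 - e) * z.2).
  rewrite /open_disk/= !exprMn -mulrDr; move: dz; rewrite /closed_disk/= => dz.
  apply: (@le_lt_trans _ _ ((1 - e) ^+ 2)); first by rewrite ler_piMr// sqr_ge0.
  by rewrite expr_lt1//; lra.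
apply: rN; rewrite /cball/=.
have E x : (1 - e) * x - x = - (e * x) by ring.
rewrite !E !sqrrN !exprMn -mulrDr; apply: (@le_trans _ _ (e ^+ 2)).
  by rewrite ler_piMr// sqr_ge0.
by rewrite ler_pXn2r// nnegrE ltW.
Qed.

Lemma disk_image_closed (T : topologicalType) (f : P -> T) (Q : set T) :
  contin_on (closed_disk R) f -> closed Q ->
  (forall z, open_disk R z -> Q (f z)) -> forall z, closed_disk R z -> Q (f z).
Proof.
move=> fc; rewrite -openC => oQ fQ z dz; apply: contrapT => nQ.
have n : nbhs (f z) (~` Q) by exact: open_nbhs_nbhs.
have [w ow] := disk_dense dz (contin_on_near fc dz n).
by move=> /(_ (open_sub_disk ow)); apply; exact: fQ.
Qed.

(** On [Y], which misses [C], the open set [E] and the closed set made of [E] and [C] have the same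
    trace. *)
Lemma connected_side (T : topologicalType) (Y E C : set T) :
  connected Y -> open E -> open (~` (E `|` C)) ->
  (forall y, Y y -> ~ C y) -> (exists2 y, Y y & E y) -> Y `<=` E.
Proof.
move=> cY oE oEC YC [y Yy Ey].
suff <- : Y `&` E = Y by move=> x [].
apply: cY; first by exists y.
- by exists E.
exists (E `|` C); first by rewrite -openC.
apply/seteqP; split => x [Yx]; first by move=> Ex; split=> //; left.
by case=> // Cx; case: (YC x Yx Cx).
Qed.

(* [E] is the side of the circle on which the disk [phi] lies. *)
Lemma disk_side (S : topologicalType) (D : set S) (h phi : P -> S) :
  surface R S -> homeomorphism_on (closed_disk R) D h ->
  contin_on (closed_disk R) phi -> connected (phi @` open_disk R) ->
  (forall z, open_disk R z -> ~ (h @` unit_circle R) (phi z)) ->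
  exists E : set S,
    [/\ open E, open (~` (E `|` h @` unit_circle R)),
        forall z, open_disk R z -> E (phi z) &
        forall A M x0, compact A -> A `<=` unit_circle R ->
          (forall z w, (open_disk R `|` A) z -> (open_disk R `|` A) w ->
            phi z = phi w -> z = w) ->
          A x0 -> (h @` unit_circle R) (phi x0) ->
          nbhs (phi x0) (fun y => (h @` unit_circle R) y -> (phi @` A) y) ->
          nbhs x0 M ->
          nbhs (phi x0) (fun y => E y -> (phi @` (M `&` open_disk R)) y)].
Proof.
move=> hS [[hD hi hs] /contin_onP hc [g /contin_onP gc gK]] pc cF pC.
have [hT _ _ _] := hS; have iS := surface_domain_invariant hS.
have hinj z w : closed_disk R z -> closed_disk R w -> h z = h w -> z = w.
  by move=> dz dw; apply: hi; rewrite inE.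
have hgK y : D y -> h (g y) = y by move=> /hs[z dz <-]; rewrite gK.
pose D0 := h @` open_disk R; pose C := h @` unit_circle R.
have oD0 : open D0.
  rewrite openE => _ [z oz <-].
  have nz : nbhs z (fun w => setT w -> 0 < 1 - (w.1 ^+ 2 + w.2 ^+ 2)).
    apply: contin_on_near_gt0 => //; first by contin.
    by rewrite subr_gt0.
  have [r r0 rO] := cball_nbhs nz.
  have sO w : cball z r w -> open_disk R w.
    by move=> /rO /(_ I); rewrite subr_gt0.
  have sD w : cball z r w -> closed_disk R w by move=> /sO/open_sub_disk.
  have := iS h z r r0 (contin_on_sub sD hc) _; rewrite /interior => H.
  apply: filterS (H _); first by move=> _ [w /sO ow <-]; exists w.
  by move=> a b /sD da /sD db; exact: hinj.
have DE : D = D0 `|` C.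
  apply/seteqP; split => [y /hs[z /disk_cases[oz|cz] <-]|_ [[z oz <-]|[z cz <-]]].
  - by left; exists z.
  - by right; exists z.
  - exact/hD/open_sub_disk.
  - exact/hD/circle_sub_disk.
have cD : closed D.
  have -> : D = h @` closed_disk R.
    by apply/seteqP; split => [y /hs|_ [z dz <-]] //; exact: hD.
  apply: compact_closed => //; apply: continuous_compact compact_disk.
  exact/contin_onP.
have D0C y : D0 y -> ~ C y.
  move=> [z oz <-] [w cw e].
  have {}e : w = z by apply: hinj => //; [exact: circle_sub_disk|exact: open_sub_disk].
  by move: oz cw; rewrite e /open_disk/unit_circle/= => + e1; rewrite e1 ltxx.
(* The image of the open disk under [phi] is connected and misses the circle: either it lies in [D0]
   or it avoids [D]. *)
have [F0|F0] := pselect (exists2 y, (phi @` open_disk R) y & D0 y).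
- have FD0 z : open_disk R z -> D0 (phi z).
    move=> oz; apply: (connected_side (C := C) cF oD0 _ _ F0).
    + by rewrite -DE openC.
    + by move=> _ [w ow <-]; exact: pC.
    + by exists z.
  exists D0; split=> //; first by rewrite -/C -DE openC.
  move=> A M x0 cA AC pi Ax0 Cx0 nC nM.
  have pD z : closed_disk R z -> D (phi z).
    by apply: (disk_image_closed (Q := D)) => // w /FD0; rewrite DE; left.
  (* Inside [D], the gluing is done in the plane after applying [g]: [k] turns the punctured disk
     inside out, fixing the circle, to supply the outer side. *)
  pose k z : P := ((2 - norm2 z) * (radial z).1, (2 - norm2 z) * (radial z).2).
  have norm_k z : punctured_disk z -> 1 <= norm2 (k z) /\ norm2 (k z) = 2 - norm2 z.
    move=> [/radial_on_circle cz dz].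
    have z1 : norm2 z <= 1.
      by rewrite -(@expr_le1 _ 2) ?norm2_ge0// norm2_sqr.
    by rewrite norm2_scale//; [split=> //|]; lra.
  have k_open z : punctured_disk z -> ~ open_disk R (k z).
    move=> /norm_k[k1 _] ok; have : norm2 (k z) ^+ 2 < 1 by rewrite norm2_sqr.
    by rewrite ltNge exprn_ege1.
  have g_open y : D0 y -> open_disk R (g y).
    by move=> [z oz <-]; rewrite gK//; exact: open_sub_disk.
  have kC z : unit_circle R z -> k z = z.
    move=> cz; rewrite /k norm2_circle// radial_circle//.
    by rewrite (_ : 2 - 1 = 1) ?mul1r; [case: (z)|ring].
  have ginj y y' : D y -> D y' -> g y = g y' -> y = y'.
    by move=> Dy Dy' e; rewrite -(hgK y)// e hgK.
  have cp : unit_circle R (g (phi x0)).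
    by case: Cx0 => w cw <-; rewrite gK//; exact: circle_sub_disk.
  have Dx0 : D (phi x0) by exact/pD/circle_sub_disk/AC.
  have AD z : (open_disk R `|` A) z -> closed_disk R z.
    by case=> [/open_sub_disk|/AC/circle_sub_disk].
  have := @glue_disks _ k (fun z => g (phi z)) A M (g (phi x0)) x0.
  have hP : hausdorff_space (R * R)%type by exact: norm_hausdorff.
  move=> /(_ hP plane_domain_invariant).
  have kc : contin_on punctured_disk k.
    have nc := contin_norm2 (X := punctured_disk).
    have rc : contin_on punctured_disk radial by apply: contin_radial => z [].
    by rewrite /k; contin.
  move=> /(_ kc) H.
  have {H} : nbhs (k (g (phi x0)))
      (k @` punctured_disk `|` (fun z => g (phi z)) @` (M `&` open_disk R)).
    apply: H => //.
    + move=> z w pz pw e; have [_ nz] := norm_k _ pz; have [_ nw] := norm_k _ pw.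
      have en : norm2 z = norm2 w.
        by have := congr1 norm2 e; rewrite nz nw => /addrI/oppr_inj.
      apply: radial_inj => //; first by case: pz.
      have n0 : 2 - norm2 w != 0 by rewrite -nw; have [] := norm_k _ pw; lra.
      move: e; rewrite /k /radial en => -[/(mulfI n0) e1 /(mulfI n0) e2].
      by rewrite e1 e2.
    + exact: contin_on_comp pc gc pD.
    + move=> z w az aw /ginj e; apply: pi => //; apply: e; exact/pD/AD.
    + by move=> z w /k_open kz ow e; apply: kz; rewrite e; exact/g_open/FD0.
    + by rewrite kC.
    + have := @contin_on_near _ _ _ _ (g (phi x0)) (fun y => C y -> (phi @` A) y) hc.
      move=> /(_ (circle_sub_disk cp)); rewrite hgK// => /(_ nC).
      apply: filterS => w hw cw; rewrite kC//.
      have [|a Aa e] := hw (circle_sub_disk cw); first by exists w.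
      by exists a => //; rewrite e gK//; exact: circle_sub_disk.
  rewrite kC// => H.
  (* For y in [D0] the point [g y] has norm below 1, while values of [k] have norm at least 1; only
     the part coming from [phi] remains. *)
  have := contin_on_near gc Dx0 H; apply: filterS => y hy Ey.
  have Dy : D y by rewrite DE; left.
  case: (hy Dy) => [[z pz e]|[z [Mz oz] e]].
    by case: (k_open z pz); rewrite e; exact: g_open.
  by exists z => //; apply: ginj => //; exact/pD/open_sub_disk.
(* Outside [D], the gluing is done in the surface itself, with [h] in the role of [k]. *)
- have FD z : open_disk R z -> ~ D (phi z).
    move=> oz; rewrite DE => -[d|]; last exact: pC.
    by apply: F0; exists (phi z) => //; exists z.
  exists (~` D); split=> //.
  + by rewrite openC.
  + suff -> : ~` (~` D `|` h @` unit_circle R) = D0 by [].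
    rewrite setCU setCK DE; apply/seteqP; split => y; first by case=> -[].
    by move=> Dy; split; [left|exact: D0C].
  move=> A M x0 cA AC pi Ax0 [p cp e] nC nM.
  rewrite -e in nC *.
  have pdD z : punctured_disk z -> closed_disk R z by case.
  have : nbhs (h p) (h @` punctured_disk `|` phi @` (M `&` open_disk R)).
    apply: (glue_disks hT iS (A := A) (x0 := x0)) => //.
    + exact: contin_on_sub pdD hc.
    + by move=> z w /pdD dz /pdD dw; exact: hinj.
    + by move=> z w /pdD dz /FD nD e'; apply: nD; rewrite -e'; exact: hD.
    + have := contin_on_near hc (circle_sub_disk cp) nC.
      by apply: filterS => w hw cw; apply: hw; [exact: circle_sub_disk|exists w].
  apply: filterS => y [[z /pdD dz <-]|//] nD.
  by case: nD; exact: hD.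
Qed.

End Plane.

(** * Boundary walks *)

(** Here the size of a large face enters: a vertex met again three steps later is met at a different
    index. *)
Lemma ordS3_neq m (j : 'I_m) : (3 < m)%N -> ordS (ordS (ordS j)) <> j.
Proof.
have modS k : ((k %% m).+1 %% m = k.+1 %% m)%N by rewrite -addn1 modnDml addn1.
move=> m3 /(congr1 val)/=; rewrite modS -addn2 modnDml addn2 => e.
have : (j + 3 == j + 0 %[mod m])%N by rewrite addn3 addn0 e modn_small.
by rewrite eqn_modDl mod0n modn_small.
Qed.

(** * Corners and arcs of the unit circle *)

Section Corners.
Variables (R : realType) (m : nat).

Definition corner (i : 'I_m) : R * R := circle_point (corner_angle R m i).

Lemma circle_point_circle (t : R) : unit_circle R (circle_point t).
Proof. by rewrite /unit_circle/circle_point/= cos2Dsin2. Qed.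

Lemma circle_point_surj (z : R * R) : unit_circle R z ->
  exists2 t, 0 <= t <= 2 * pi & circle_point t = z.
Proof.
case: z => x y; rewrite /unit_circle/= => e.
have x1 : -1 <= x <= 1.
  rewrite -ler_norml -(@expr_le1 _ 2)// real_normK ?num_real//.
  by have := sqr_ge0 y; lra.
have [/andP[a0 api] ca] := acos_def x1; have p0 := pi_gt0 R.
have sa : sin (acos x) = `|y|.
  by rewrite sin_acos// -sqrtr_sqr; congr Num.sqrt; lra.
have [y0|y0] := leP 0 y.
  exists (acos x); first by rewrite a0/=; lra.
  by rewrite /circle_point ca sa ger0_norm.
exists (2 * pi - acos x); first by apply/andP; split; lra.
have -> : 2 * pi - acos x = - acos x + pi *+ 2 by rewrite mulr2n; ring.
by rewrite /circle_point cosD2pi sinD2pi cosN sinN ca sa ltr0_norm// opprK.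
Qed.

Lemma corner_angle0 : corner_angle R m 0 = 0.
Proof. by rewrite /corner_angle mulr0 mul0r. Qed.

Lemma corner_angle_lt i j : (0 < m)%N -> (i < j)%N ->
  corner_angle R m i < corner_angle R m j.
Proof.
move=> m0 ij; rewrite /corner_angle ltr_pM2r ?invr_gt0 ?ltr0n//.
by rewrite ltr_pM2l ?ltr_nat// mulr_gt0// pi_gt0.
Qed.

Lemma corner_anglem : (0 < m)%N -> corner_angle R m m = 2 * pi.
Proof. by move=> m0; rewrite /corner_angle mulfK// pnatr_eq0 -lt0n. Qed.

Lemma circle_arc_cover z : (0 < m)%N -> unit_circle R z ->
  exists i : 'I_m, circle_arc R i z.
Proof.
move=> m0 /circle_point_surj[t /andP[t0 t1] <-].
(* Induction on [n] locates the angle [t] between two consecutive corner angles. *)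
have K n : (0 < n)%N -> t <= corner_angle R m n ->
    exists2 i, (i < n)%N & corner_angle R m i <= t <= corner_angle R m i.+1.
  elim: n => // n IH _ tn; case: n => [|n] in IH tn *.
    by exists 0%N => //; rewrite corner_angle0 t0.
  have [/IH[]// i ni it|nt] := leP t (corner_angle R m n.+1).
    by exists i => //; rewrite (leq_trans ni).
  by exists n.+1 => //; rewrite (ltW nt).
have [|i im it] := K m m0; first by rewrite corner_anglem.
by exists (Ordinal im); exists t => //=; rewrite in_itv.
Qed.

(** Two equal corners would have angles with difference d strictly between 0 and 2 pi and cos d = 1,
    but 1 - cos d = 2 sin(d / 2)^2 > 0. *)
Lemma corner_inj : injective corner.
Proof.
suff K (i j : 'I_m) : (i < j)%N -> corner i <> corner j.
  move=> i j e; apply/val_inj; case: (ltngtP i j) => // ij; first by case: (K i j ij).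
  by case: (K j i ij).
move=> ij [ec es]; have m0 : (0 < m)%N by exact: leq_ltn_trans (ltn_ord i).
pose d := corner_angle R m j - corner_angle R m i.
have d0 : 0 < d by rewrite subr_gt0 corner_angle_lt.
have d1 : d < 2 * pi.
  rewrite -(corner_anglem m0); have := corner_angle_lt m0 (ltn_ord j).
  suff : 0 <= corner_angle R m i by rewrite /d; lra.
  by rewrite /corner_angle !mulr_ge0 ?invr_ge0 ?ler0n// pi_ge0.
have cd : cos d = 1 by rewrite cosB ec es -!expr2 cos2Dsin2.
have s0 : 0 < sin (d / 2) by apply: sin_gt0_pi; lra.
have := cos2Dsin2 (d / 2).
have e2 : d = (d / 2) *+ 2 by rewrite mulr2n; lra.
move: cd; rewrite e2 cos_mulr2n -e2 mulr2n => cd.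
have : 0 < sin (d / 2) ^+ 2 by rewrite exprn_gt0.
by lra.
Qed.

Lemma corner_arc (i : 'I_m) : circle_arc R i (corner i).
Proof.
exists (corner_angle R m i) => //=; rewrite in_itv/= lexx/= ltW//.
by apply: corner_angle_lt => //; exact: leq_ltn_trans (ltn_ord i).
Qed.

(** For the last index the successor wraps to 0, while the angle reaches 2 pi; periodicity
    identifies the two points. *)
Lemma corner_ordS (i : 'I_m) : corner (ordS i) = circle_point (corner_angle R m i.+1).
Proof.
have m0 : (0 < m)%N by exact: leq_ltn_trans (ltn_ord i).
rewrite /corner /=; have := ltn_ord i; rewrite leq_eqVlt => /orP[/eqP e|im].
  rewrite e modnn corner_angle0 corner_anglem// /circle_point.
  have -> : 2 * pi = pi *+ 2 :> R by rewrite mulr2n; ring.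
  by rewrite cos0 sin0 cos2pi sin2pi.
by rewrite modn_small.
Qed.

Lemma corner_arcS (i : 'I_m) : circle_arc R i (corner (ordS i)).
Proof.
rewrite corner_ordS; exists (corner_angle R m i.+1) => //=.
rewrite in_itv/= lexx andbT ltW//.
by apply: corner_angle_lt => //; exact: leq_ltn_trans (ltn_ord i).
Qed.

Lemma circle_arc_circle (i : 'I_m) : circle_arc R i `<=` unit_circle R.
Proof. by move=> _ [t _ <-]; exact: circle_point_circle. Qed.

Lemma corner_circle (i : 'I_m) : unit_circle R (corner i).
Proof. exact: circle_point_circle. Qed.

Lemma circle_arc_compact (i : 'I_m) : compact (circle_arc R i).
Proof.
apply: continuous_compact; last exact: segment_compact.
apply/contin_onP; rewrite /circle_point; apply: contin_on_pair.
  by apply: continuous_contin_on; exact: continuous_cos.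
by apply: continuous_contin_on; exact: continuous_sin.
Qed.

End Corners.

(** * Edges of an embedded graph *)

Section EmbeddedGraph.
Variables (R : realType) (S : topologicalType) (G : embedded_graph R S).
Implicit Types u w : vertex G.

Lemma adj_neq u w : adj u w -> u <> w.
Proof. by move=> + e; rewrite e adj_irrefl. Qed.

Lemma edge_support u w : adj u w -> edge u w `<=` graph_support G.
Proof. by move=> uw x ux; right; exists u, w. Qed.

Lemma edge_closed u w : hausdorff_space S -> adj u w -> closed (edge u w).
Proof.
move=> hT /edge_arc[f [[[fD _ fs] fc _] _ _]].
have -> : edge u w = f @` `[0, 1].
  by apply/seteqP; split => [y /fs|_ [z dz <-]] //; exact: fD.
by apply: compact_closed => //; apply: continuous_compact fc _; exact: segment_compact.
Qed.

(** A common point of distinct edges is a vertex, and it must be an endpoint of both. *)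
Lemma edge_meet u w w' y : adj u w -> adj u w' -> w <> w' ->
  edge u w y -> edge u w' y -> y = vpoint u.
Proof.
move=> uw uw' ww' ey ey'.
have [||x _ xy] := edge_disjoint uw uw' _ _ (conj ey ey').
- by case.
- by case=> e; case: (adj_neq uw').
rewrite -xy in ey ey' *.
have [-> //|xw] := edge_point uw ey; have [-> //|xw'] := edge_point uw' ey'.
by case: ww'; rewrite -xw -xw'.
Qed.

End EmbeddedGraph.

(** * The walk around an irreducible face *)

Section BoundaryWalk.
Variables (R : realType) (S : topologicalType) (G : embedded_graph R S).
Variables (F : set S) (m : nat) (v : 'I_m -> vertex G) (phi : R * R -> S).
Hypothesis surfS : surface R S.
Hypothesis faceF : is_face G F.
Hypothesis phi_contin : contin_on (closed_disk R) phi.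
Hypothesis phi_open : homeomorphism_on (open_disk R) F phi.
Hypothesis phi_arc : forall i : 'I_m,
  [/\ adj (v i) (v (ordS i)),
      homeomorphism_on (circle_arc R i) (edge (v i) (v (ordS i))) phi &
      phi (circle_point (corner_angle R m i)) = vpoint (v i)].

Lemma walk_adj i : adj (v i) (v (ordS i)).
Proof. by have [] := phi_arc i. Qed.

Lemma phi_corner i : phi (corner R i) = vpoint (v i).
Proof. by have [] := phi_arc i. Qed.

Lemma phi_arc_edge i z : circle_arc R i z -> edge (v i) (v (ordS i)) (phi z).
Proof. by have [_ [[h _ _] _ _] _] := phi_arc i => /h. Qed.

Lemma phi_arc_inj (i : 'I_m) z w : circle_arc R i z -> circle_arc R i w ->
  phi z = phi w -> z = w.
Proof.
by have [_ [[_ h _] _ _] _] := phi_arc i => dz dw; apply: h; rewrite inE.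
Qed.

Lemma face_disjoint y : F y -> ~ graph_support G y.
Proof. by case: faceF => x _ -> /connected_component_sub. Qed.

Lemma phi_face z : open_disk R z -> F (phi z).
Proof. by have [[h _ _] _ _] := phi_open => /h. Qed.

Lemma phi_open_inj z w : open_disk R z -> open_disk R w -> phi z = phi w -> z = w.
Proof. by have [[_ h _] _ _] := phi_open => dz dw; apply: h; rewrite inE. Qed.

Lemma phi_open_connected : connected (phi @` open_disk R).
Proof.
have -> : phi @` open_disk R = F.
  have [[_ _ h] _ _] := phi_open.
  by apply/seteqP; split => [_ [z oz <-]|y /h//]; exact: phi_face.
by case: faceF => x _ ->; exact: component_connected.
Qed.

(** [disk_side] for the two arcs at the corner. They are glued injectively because [v i] and
    [v (ordS (ordS i))], being adjacent, are distinct. *)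
Lemma corner_side i C :
  adj (v i) (v (ordS (ordS i))) -> bounds_disk R C ->
  C = three_cycle_set (v i) (v (ordS i)) (v (ordS (ordS i))) ->
  exists E : set S,
    [/\ open E, open (~` (E `|` C)), forall z, open_disk R z -> E (phi z) &
        forall M, nbhs (corner R (ordS i)) M ->
          nbhs (vpoint (v (ordS i)))
            (fun y => E y -> (phi @` (M `&` open_disk R)) y)].
Proof.
have [hT _ _ _] := surfS.
move=> ac [D [h [hD <-]]] CE; rewrite CE.
have [ab bc] := (walk_adj i, walk_adj (ordS i)).
have ba : adj (v (ordS i)) (v i) by rewrite adj_sym.
have ca : adj (v (ordS (ordS i))) (v i) by rewrite adj_sym.
have CG : three_cycle_set (v i) (v (ordS i)) (v (ordS (ordS i))) `<=` graph_support G.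
  by move=> y [[]|]; exact: edge_support.
have [|E [oE oEC EF side]] := disk_side surfS hD phi_contin phi_open_connected.
  by move=> z oz; rewrite CE => /CG; apply/face_disjoint/phi_face.
rewrite CE in oEC side; exists E; split=> // M nM.
pose A := circle_arc R i `|` circle_arc R (ordS i).
rewrite -phi_corner; apply: (side A) => //.
- by apply: compactU; exact: circle_arc_compact.
- by move=> z []; exact: circle_arc_circle.
- have FA z w : open_disk R z -> A w -> phi z <> phi w.
    move=> /phi_face/face_disjoint nz [] /phi_arc_edge ew e; apply: nz; rewrite e.
      exact: edge_support ew.
    exact: edge_support ew.
  have K z w : circle_arc R i z -> circle_arc R (ordS i) w -> phi z = phi w -> z = w.
    move=> az aw e.
    have ez : edge (v (ordS i)) (v i) (phi z).
      by rewrite -edge_sym//; exact: phi_arc_edge.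
    have ew : edge (v (ordS i)) (v (ordS (ordS i))) (phi z).
      by rewrite e; exact: phi_arc_edge.
    have pz := edge_meet ba bc (adj_neq ac) ez ew.
    rewrite (phi_arc_inj az (corner_arcS R i)) ?phi_corner//.
    by rewrite (phi_arc_inj aw (corner_arc R _)) ?phi_corner// -e.
  move=> z w [oz|Az] [ow|Aw].
  + exact: phi_open_inj.
  + by move=> e; case: (FA z w).
  + by move=> /esym e; case: (FA w z).
  + case: Az Aw => az [] aw;
      [exact: (phi_arc_inj az aw)|exact: K| |exact: (phi_arc_inj az aw)].
    by move=> /esym e; apply: esym; exact: K.
- by left; exact: corner_arcS.
- by left; left; apply: phi_arc_edge; exact: corner_arcS.
(* The third edge is closed and misses the middle vertex, so near that vertex the cycle consists of
   the images of the two arcs. *)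
- have : nbhs (phi (corner R (ordS i))) (~` edge (v (ordS (ordS i))) (v i)).
    apply: open_nbhs_nbhs; split; first by rewrite openC; exact: edge_closed.
    rewrite phi_corner => /(edge_point ca)[] e.
      by case: (adj_neq bc).
    by case: (adj_neq ba).
  apply: filterS => y nca [[ey|ey]|//].
    have [_ [[_ _ hs] _ _] _] := phi_arc i.
    by have [z az <-] := hs _ ey; exists z => //; left.
  have [_ [[_ _ hs] _ _] _] := phi_arc (ordS i).
  by have [z az <-] := hs _ ey; exists z => //; right.
Qed.

(* Near the corner, the side of the circle containing the face is filled by the
   face, so no other edge and no other corner can reach [v (ordS i)] there. *)
Lemma corner_neighbors i j :
  adj (v i) (v (ordS (ordS i))) ->
  bounds_disk R (three_cycle_set (v i) (v (ordS i)) (v (ordS (ordS i)))) ->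
  adj (v (ordS i)) (v j) -> v j = v i \/ v j = v (ordS (ordS i)).
Proof.
move=> ac bd bw; apply: contrapT => /not_orP[wa wc].
have [E [oE oEC EF side]] := corner_side ac bd erefl.
have [ab bc] := (walk_adj i, walk_adj (ordS i)).
have ba : adj (v (ordS i)) (v i) by rewrite adj_sym.
have ca : adj (v (ordS (ordS i))) (v i) by rewrite adj_sym.
set C := three_cycle_set _ _ _ in oEC.
have nb := adj_neq bw.
(* [v j] lies on the boundary of the face, hence in [E] or [C]; it is none of the three vertices of
   the cycle. *)
have Ew : E (vpoint (v j)).
  have cEC : closed (E `|` C) by rewrite -openC.
  have := disk_image_closed phi_contin cEC (fun z oz => or_introl (EF z oz))
    (circle_sub_disk (corner_circle R j)).
  rewrite phi_corner => -[//|[[]|]].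
  - by move=> /(edge_point ab)[//|e]; case: nb.
  - by move=> /(edge_point bc)[e|//]; case: nb.
  - by move=> /(edge_point ca)[].
have [f [[[fD fi _] /contin_onP fc _] f0 f1]] := edge_arc bw.
have sub01 : `]0, 1]%classic `<=` (`[0, 1]%classic : set R).
  by move=> t; rewrite /= !in_itv/= => /andP[/ltW -> ->].
have I0 : (`[0, 1]%classic : set R) 0 by rewrite /= in_itv/= lexx ler01.
have fne t : (`]0, 1]%classic : set R) t -> f t <> vpoint (v (ordS i)).
  move=> t01; rewrite -f0 => e; have e0 : t = 0.
    by apply: fi => //; rewrite inE//; exact: sub01.
  by move: t01; rewrite e0 /= in_itv/= ltxx.
have YC y : (f @` `]0, 1]) y -> ~ C y.
  move=> [t t01 <-]; have et := fD _ (sub01 _ t01).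
  case=> [[]|].
  - by rewrite edge_sym// => /(edge_meet bw ba wa et)/fne; apply.
  - by move=> /(edge_meet bw bc wc et)/fne; apply.
  - move=> ec; have [||x _ xy] := edge_disjoint bw ca _ _ (conj et ec).
    + by case=> _ /wa.
    + by case=> _ /wc.
    rewrite -xy in et ec.
    case: (edge_point bw et) => xe; case: (edge_point ca ec) => xe'.
    + by case: (adj_neq bc); rewrite -xe -xe'.
    + by case: (adj_neq ba); rewrite -xe -xe'.
    + by case: wc; rewrite -xe -xe'.
    + by case: wa; rewrite -xe -xe'.
(* Without its starting point, the edge to [v j] is connected and misses [C]; its other end lies in
   [E]. *)
have YE : f @` `]0, 1] `<=` E.
  apply: (connected_side (C := C)) => //.
  - apply: connected_continuous_connected.
      by apply/connected_intervalP; exact: interval_is_interval.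
    by apply/contin_onP; exact: contin_on_sub sub01 fc.
  - exists (vpoint (v j)) => //; exists 1 => //=.
    by rewrite in_itv/= ltr01 lexx.
have N : nbhs (f 0) (fun y => E y -> (phi @` (setT `&` open_disk R)) y).
  by rewrite f0; apply: side; exact: filterT.
have /nbhs_ballP[e /= e0 eN] := contin_on_near fc I0 N.
(* A positive parameter so small that [f t] lies where [E] is filled by the face; yet [f t] is on an
   edge. *)
pose t := Num.min (e / 2) 1.
have t0 : 0 < t by rewrite lt_min ltr01 divr_gt0.
have t1 : t <= 1 by rewrite ge_min lexx orbT.
have te : t < e.
  by rewrite (@le_lt_trans _ _ (e / 2)) ?ge_min ?lexx//; lra.
have t01 : (`]0, 1]%classic : set R) t by rewrite /= in_itv/= t0 t1.
have [||z [_ oz] ez] := eN t _ (sub01 _ t01) (YE (f t) _).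
- by rewrite /ball/= sub0r normrN gtr0_norm.
- by exists t.
apply: (face_disjoint (phi_face oz)); rewrite ez.
by apply: (edge_support bw); exact/fD/sub01.
Qed.

(** Separate two such corners by disjoint neighbourhoods. Near the common vertex [E] is filled by
    the image of one of them, so a point of the open disk close to the other corner would share its
    value with a second point. *)
Lemma corner_unique i j :
  adj (v i) (v (ordS (ordS i))) ->
  bounds_disk R (three_cycle_set (v i) (v (ordS i)) (v (ordS (ordS i)))) ->
  v j = v (ordS i) -> j = ordS i.
Proof.
move=> ac bd e; apply: contrapT => /eqP ne.
have [E [oE oEC EF side]] := corner_side ac bd erefl.
have hP : hausdorff_space (R * R)%type by exact: norm_hausdorff.
have nc : corner R (ordS i) != corner R j.
  by apply/eqP => /corner_inj/esym; apply/eqP.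
move: hP; rewrite open_hausdorff => /(_ _ _ nc)[[M M'] /= [iM iM'] [oM oM' MM']].
rewrite !inE in iM iM'.
have N := side M (open_nbhs_nbhs (conj oM iM)).
rewrite -e -phi_corner in N.
have dj := circle_sub_disk (corner_circle R j).
have [z oz [M'z Nz]] := disk_dense dj
  (filterI (open_nbhs_nbhs (conj oM' iM')) (contin_on_near phi_contin dj N)).
have [w [Mw ow] ew] := Nz (open_sub_disk oz) (EF z oz).
have wz := phi_open_inj ow oz ew; rewrite wz in Mw.
by move: MM' => /eqP MM'; have : (M `&` M') z by []; rewrite MM'.
Qed.

(* If the triangle bounded a disk, the walk would be forced to go round it
   again and to pass twice through [v (ordS i)]. *)
Lemma walk_triangle_essential i : (4 <= m)%N ->
  (forall i, adj (v i) (v (ordS (ordS i)))) ->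
  ~ bounds_disk R (three_cycle_set (v i) (v (ordS i)) (v (ordS (ordS i)))).
Proof.
move=> m4 irr bd.
pose i1 := ordS i; pose i2 := ordS i1; pose i3 := ordS i2; pose i4 := ordS i3.
(* [v i3] is adjacent to [v i1] by irreducibility and differs from its neighbour [v i2]. *)
have e3 : v i3 = v i.
  have [//|e] := corner_neighbors (irr i) bd (irr i1).
  by have := adj_neq (walk_adj i2); rewrite -/i3 e.
(* Since [v i3] is [v i], the next triangle is the same one, and the argument repeats at [v i2]. *)
have bd' : bounds_disk R (three_cycle_set (v i1) (v i2) (v i3)).
  suff -> : three_cycle_set (v i1) (v i2) (v i3) = three_cycle_set (v i) (v i1) (v i2).
    by [].
  by rewrite e3 /three_cycle_set setUC setUA.
have e4 : v i4 = v i1.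
  have [//|e] := corner_neighbors (irr i1) bd' (irr i2).
  by have := adj_neq (walk_adj i3); rewrite -/i4 e.
have := corner_unique (irr i) bd e4.
exact: ordS3_neq.
Qed.

(** The midpoint of the edge is no vertex and lies in the image of the closed disk, hence on some
    edge of the walk; distinct edges meet only at vertices. *)
Lemma boundary_edge a b : (0 < m)%N -> adj a b -> edge a b `<=` closure F ->
  exists i, (a = v i /\ b = v (ordS i)) \/ (a = v (ordS i) /\ b = v i).
Proof.
move=> m0 ab abF; have [hT _ _ _] := surfS.
have Fphi : closure F `<=` phi @` closed_disk R.
  have cl : closed (phi @` closed_disk R).
    apply: compact_closed => //; apply: continuous_compact (@compact_disk R).
    exact/contin_onP.
  apply: (@subset_trans _ (closure (phi @` closed_disk R))).
    apply: closure_subset => y Fy; have [[_ _ h] _ _] := phi_open.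
    by have [z oz <-] := h _ Fy; exists z => //; exact: open_sub_disk.
  by rewrite -(closure_id _).1.
have [f [[[fD fi _] _ _] f0 f1]] := edge_arc ab.
pose h : R := 2^-1.
have hI : (`[0, 1]%classic : set R) h by rewrite /= in_itv/= /h; apply/andP; split; lra.
have I0 : (`[0, 1]%classic : set R) 0 by rewrite /= in_itv/= lexx ler01.
have I1 : (`[0, 1]%classic : set R) 1 by rewrite /= in_itv/= lexx ler01.
have ey := fD _ hI.
have ny : ~ range (@vpoint R S G) (f h).
  move=> [x _ xe]; move: (ey); rewrite -xe => /(edge_point ab)[] e; move: xe; rewrite e.
    rewrite -f0 => /fi; rewrite !inE => /(_ I0 hI) /esym; rewrite /h; lra.
  rewrite -f1 => /fi; rewrite !inE => /(_ I1 hI) /esym; rewrite /h; lra.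
have [z /disk_cases[oz|cz] ez] := Fphi _ (abF _ ey).
  by case: (face_disjoint (phi_face oz)); rewrite ez; exact: edge_support ey.
have [i iz] := circle_arc_cover m0 cz.
have ei := phi_arc_edge iz; rewrite ez in ei.
exists i; apply: contrapT => /not_orP[n1 n2]; apply: ny.
exact: (edge_disjoint ab (walk_adj i) n1 n2 (conj ey ei)).
Qed.

End BoundaryWalk.

Theorem theorem1 (R : realType) (S : topologicalType) (hS : surface R S)
    (G : embedded_graph R S) (hG : is_map G)
    (F : set S) (hF : irreducible_face G F)
    (a b : vertex G) (hab : adj a b) (hbd : on_boundary F a b) :
  essentially_noncontractible a b.
Proof.
have [faceF [m [v [[m0 [phi [/contin_onP pc po pa]]] m4 irr]]]] := hF.
have [|i ab] := boundary_edge hS faceF pc po pa m0 hab.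
  by move=> y /hbd[].
have ess := walk_triangle_essential hS faceF pc po pa (i := i) m4 irr.
have vS k : adj (v k) (v (ordS k)) by have [] := pa k.
(* The third vertex is two steps along the walk, whichever way the edge is traversed. *)
exists (v (ordS (ordS i))).
case: ab => -[ea eb]; rewrite ea eb; split=> //.
- by split=> //; rewrite adj_sym.
- by split=> //; rewrite adj_sym.
suff -> : three_cycle_set (v (ordS i)) (v i) (v (ordS (ordS i))) =
          three_cycle_set (v i) (v (ordS i)) (v (ordS (ordS i))) by [].
rewrite /three_cycle_set (edge_sym (vS i)) (edge_sym (irr i)).
by rewrite (edge_sym (vS (ordS i))) setUAC.
Qed.
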